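(* Let $\mu\in\mathbb R$, $\sigma>0$, $\ell>0$, let $P=\mathcal N(\mu,\sigma^2)$ be the normal distribution on $\mathbb R$, and let $k(x,y)=\frac1{\sqrt{2\pi\ell^2}}e^{-\frac{(x-y)^2}{2\ell^2}}$ for $x,y\in\mathbb R$. Then the embedding of $P$ is $$P_k(x)=\int_{\mathbb R}k(x,y)\,P(\mathrm dy)=\frac1{\sqrt{2\pi(\sigma^2+\ell^2)}}e^{-\frac{(x-\mu)^2}{2(\sigma^2+\ell^2)}},\qquad x\in\mathbb R.$$ Moreover, let $x_1,\dots,x_n\in\mathbb R$ be pairwise distinct, $\boldsymbol K(\boldsymbol x)=\bigl(k(x_i,x_j)\bigr)_{i,j=1}^n$ and $\boldsymbol m(\boldsymbol x)=\bigl(P_k(x_i)\bigr)_{i=1}^n$. Among all real weight vectors $\boldsymbol w\in\mathbb R^n$, the weights minimizing $\|P_k-\sum_{i=1}^nw_i\,k(x_i,\cdot)\|_k$ are $\boldsymbol w=\boldsymbol K(\boldsymbol x)^{-1}\boldsymbol m(\boldsymbol x)$, and for the corresponding measure $\mu^n=\sum_{i=1}^nw_i\,\delta_{x_i}$ one has $$\operatorname{MMD}(P,\mu^n)^2=\frac1{\sqrt{2\pi(2\sigma^2+\ell^2)}}-\frac1{2\pi(\sigma^2+\ell^2)}\sum_{i,j=1}^ne^{-\frac{(x_i-\mu)^2+(x_j-\mu)^2}{2(\sigma^2+\ell^2)}}\,\bigl(\boldsymbol K(\boldsymbol x)^{-1}\bigr)_{ij}.$$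
   Context: $(\mathcal H_k,\|\cdot\|_k)$ is the reproducing kernel Hilbert space of functions on $\mathbb R$ with kernel $k$, so that $\langle k(x,\cdot),k(y,\cdot)\rangle_k=k(x,y)$. The embedding of a (possibly signed) measure $\nu$ is $\nu_k(\cdot)=\int k(\cdot,\xi)\,\nu(\mathrm d\xi)\in\mathcal H_k$; in particular $\mu^n_k=\sum_iw_i\,k(x_i,\cdot)$. The maximum mean discrepancy is $\operatorname{MMD}(\nu,\rho)=\|\nu_k-\rho_k\|_k$. $\delta_x$ is the Dirac measure at $x$. *)

(* Defs.v *)
From HB Require Import structures.
From mathcomp Require Import all_boot all_order all_algebra.
From mathcomp Require Import all_classical all_reals all_analysis.

Set Implicit Arguments.
Unset Strict Implicit.
Unset Printing Implicit Defensive.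

Import Order.TTheory GRing.Theory Num.Theory.
Import numFieldNormedType.Exports.

Local Open Scope classical_set_scope.
Local Open Scope ring_scope.

(* A Hilbert space of real functions on [T] with reproducing kernel [k].  By
   the Moore-Aronszajn theorem there is at most one such space for a given [k],
   and exactly one when [k] is positive semidefinite.  The value of [rkhs_dot]
   outside of [rkhs_carrier] is unspecified. *)
Record rkhs (R : realType) (T : Type) (k : T -> T -> R) := Rkhs {
  rkhs_carrier : set (T -> R) ;
  rkhs_dot : (T -> R) -> (T -> R) -> R ;
  rkhs0 : rkhs_carrier 0 ;
  rkhs_linear_closed : forall (a : R) (f g : T -> R),
    rkhs_carrier f -> rkhs_carrier g -> rkhs_carrier (a *: f + g) ;
  rkhs_dotC : forall f g : T -> R,
    rkhs_carrier f -> rkhs_carrier g -> rkhs_dot f g = rkhs_dot g f ;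
  rkhs_dot_linear : forall (a : R) (f g h : T -> R),
    rkhs_carrier f -> rkhs_carrier g -> rkhs_carrier h ->
    rkhs_dot (a *: f + g) h = a * rkhs_dot f h + rkhs_dot g h ;
  rkhs_dot_ge0 : forall f : T -> R, rkhs_carrier f -> 0 <= rkhs_dot f f ;
  rkhs_dot_eq0 : forall f : T -> R,
    rkhs_carrier f -> rkhs_dot f f = 0 -> f = 0 ;
  rkhs_complete : forall u : nat -> T -> R,
    (forall i, rkhs_carrier (u i)) ->
    (forall e : R, 0 < e -> exists N : nat, forall i j : nat,
      (N <= i)%N -> (N <= j)%N ->
      Num.sqrt (rkhs_dot (u i - u j) (u i - u j)) < e) ->
    exists2 f : T -> R, rkhs_carrier f &
      (fun i => Num.sqrt (rkhs_dot (u i - f) (u i - f))) @ \oo --> (0 : R) ;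
  rkhs_kernel : forall x : T, rkhs_carrier (k x) ;
  rkhs_reproducing : forall (f : T -> R) (x : T),
    rkhs_carrier f -> rkhs_dot f (k x) = f x }.

Definition rkhs_norm (R : realType) (T : Type) (k : T -> T -> R) (H : rkhs k)
    (f : T -> R) : R := Num.sqrt (rkhs_dot H f f).

Section embedding.
Context {d : measure_display} {T : measurableType d} {R : realType}.
Implicit Types (nu rho : {charge set T -> \bar R}) (k : T -> T -> R).

Definition hahn_pos nu : set T := sval (cid (Hahn_decomposition nu)).

Definition hahn_neg nu : set T :=
  sval (cid (svalP (cid (Hahn_decomposition nu)))).

Lemma hahn_posneg nu : hahn_decomposition nu (hahn_pos nu) (hahn_neg nu).
Proof. exact: svalP (cid (svalP (cid (Hahn_decomposition nu)))). Qed.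

(* Integral of [f] against a signed measure through its Jordan decomposition;
   meaningful when [f] is integrable for both parts, for instance when [f] is
   bounded and measurable. *)
Definition charge_integral nu (f : T -> R) : R :=
  \int[jordan_pos (hahn_posneg nu)]_x f x
  - \int[jordan_neg (hahn_posneg nu)]_x f x.

Definition embedding k nu : T -> R :=
  fun x => charge_integral nu (fun y => k x y).

Definition MMD k (H : rkhs k) nu rho : R :=
  rkhs_norm H (embedding k nu - embedding k rho).

End embedding.

Section discrete_charge.
Local Open Scope ereal_scope.
Context {d : measure_display} {T : measurableType d} {R : realType}.
Variables (n : nat) (x : 'I_n -> T) (w : 'I_n -> R).

Definition discrete_charge : set T -> \bar R :=
  fun A => \sum_(i < n) (w i)%:E * \d_(x i) A.

Let cadd_charge (a b : {charge set T -> \bar R}) : {charge set T -> \bar R} :=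
  cadd a b.

Let scaled_dirac (i : 'I_n) : {charge set T -> \bar R} :=
  cscale (w i) (charge_of_finite_measure (\d_(x i))).

Let big_cadd : {charge set T -> \bar R} :=
  \big[cadd_charge/(czero : {charge set T -> \bar R})]_(i < n) scaled_dirac i.

Let big_caddE : big_cadd = discrete_charge :> (set T -> \bar R).
Proof.
apply/funext => A; rewrite /big_cadd /discrete_charge.
by elim/big_rec2 : _ => // i a b _ <-.
Qed.

Let discrete_charge0 : discrete_charge set0 = 0.
Proof. by rewrite -big_caddE charge0. Qed.

Let discrete_charge_finite A : measurable A -> discrete_charge A \is a fin_num.
Proof. by move=> mA; rewrite -big_caddE fin_num_measure. Qed.

Let discrete_charge_sigma_additive : semi_sigma_additive discrete_charge.
Proof. by rewrite -big_caddE; exact: charge_semi_sigma_additive. Qed.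

HB.instance Definition _ := isCharge.Build _ _ _ discrete_charge
  discrete_charge0 discrete_charge_finite discrete_charge_sigma_additive.

End discrete_charge.

Definition gauss_kernel (R : realType) (l : R)
    (x y : measurableTypeR R) : R :=
  (Num.sqrt (2 * pi * l ^+ 2))^-1 * expR (- (x - y) ^+ 2 / (2 * l ^+ 2)).

(* Main.v *)
Require Import Defs.
From mathcomp Require Import all_boot all_order all_algebra.
From mathcomp Require Import all_classical all_reals all_analysis.
From mathcomp Require Import measurable_realfun ring lra.

Import Order.TTheory GRing.Theory Num.Theory.
Import numFieldNormedType.Exports.

Local Open Scope classical_set_scope.
Local Open Scope ring_scope.

(** Three facts about [H] and the Gaussian kernel carry the proof.

    Mean element.  Evaluations on [H] are uniformly bounded because [k x x] is,
    so integration against [P] is a bounded linear form on [H].  By the Riesz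
    theorem ([rkhs_riesz]) it is the inner product with some [r]; testing it on
    [k x] shows that [r x] is the integral of [k x], so [r] is the embedding
    [Pk].  Hence [Pk] lies in [H] and its squared norm is the integral of [Pk]
    against [P] ([rkhs_mean_element]).

    Gaussian integrals.  The density of variance [a] convolved with a normal law
    of variance [s ^+ 2] is the density of variance [a + s ^+ 2]
    ([gauss_density_convolution]).  With [a = l ^+ 2] this computes [Pk], and
    with [a = sigma ^+ 2 + l ^+ 2] at the center it computes the squared norm of
    [Pk].

    Projection.  The sections [k (x i)] at distinct points are linearly
    independent ([gauss_kernel_free]), so the Gram matrix [K] is invertible.
    With the weights [w = K^-1 m] the residual vanishes at all the points, that
    is, it is orthogonal to the span of the [k (x i)].  Pythagoras then shows
    that [w] is the only minimizer and that the squared residual norm is the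
    squared norm of [Pk] minus the quadratic form of [K^-1] at [m].

    It remains to identify the embedding of the signed measure [mun] with the
    combination of the [k (x i)]: the integral against a charge may be computed
    from any decomposition as a difference of finite measures, not only from the
    Jordan one ([charge_integral_sub]). *)

(** * Hilbert space geometry and the Riesz theorem *)

(** Serves twice: for Cauchy-Schwarz, and to read off the first-order condition at
    an approximate minimizer, where [A] is the error in the minimum. *)
Lemma quadratic_ge0_discriminant (R : realType) (A B C : R) :
  0 <= C -> (forall t, 0 <= A + t * (2 * B) + t ^+ 2 * C) -> B ^+ 2 <= A * C.
Proof.
rewrite le_eqVlt => /predU1P[<- pos|C0 pos].
  have [->|B0] := eqVneq B 0; first by rewrite expr0n mulr0.
  have := pos (- (A + 1) / (2 * B)).
  rewrite divfK ?mulf_neq0// mulr0 addr0 => h.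
  by exfalso; move: h; lra.
have := pos (- B / C).
have -> : A + - B / C * (2 * B) + (- B / C) ^+ 2 * C = (A * C - B ^+ 2) / C.
  by field; rewrite gt_eqF.
by rewrite pmulr_lge0 ?invr_gt0// subr_ge0.
Qed.

Section rkhs_theory.
Context {R : realType} {T : Type} {k : T -> T -> R} (H : rkhs k).
Implicit Types f g h : T -> R.

Local Notation carrier := (rkhs_carrier H).
Local Notation "'[ f , g ]" := (rkhs_dot H f g).

Lemma rkhsD f g : carrier f -> carrier g -> carrier (f + g).
Proof.
by move=> Hf Hg; rewrite -[f]scale1r; exact: (@rkhs_linear_closed _ _ _ H).
Qed.

Lemma rkhsZ a f : carrier f -> carrier (a *: f).
Proof.
move=> Hf; rewrite -[_ *: _]addr0.
by apply: (@rkhs_linear_closed _ _ _ H) => //; exact: rkhs0.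
Qed.

Lemma rkhsB f g : carrier f -> carrier g -> carrier (f - g).
Proof. by move=> Hf Hg; rewrite -scaleN1r; apply/rkhsD/rkhsZ. Qed.

Lemma rkhs_sum n (F : 'I_n -> T -> R) :
  (forall i, carrier (F i)) -> carrier (\sum_(i < n) F i).
Proof.
by move=> HF; elim/big_ind : _ => //; [exact: rkhs0|exact: rkhsD].
Qed.

Lemma rkhs_dotDl f g h : carrier f -> carrier g -> carrier h ->
  '[f + g, h] = '[f, h] + '[g, h].
Proof.
by move=> Hf Hg Hh; rewrite -[f in LHS]scale1r rkhs_dot_linear// mul1r.
Qed.

Lemma rkhs_dot0l f : carrier f -> '[0, f] = 0.
Proof.
move=> Hf; have H0 := rkhs0 H.
have /eqP := rkhs_dotDl _ _ _ H0 H0 Hf; rewrite addr0 addrC.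
by rewrite -subr_eq subrr => /eqP<-.
Qed.

Lemma rkhs_dotZl a f h : carrier f -> carrier h -> '[a *: f, h] = a * '[f, h].
Proof.
move=> Hf Hh; rewrite -[_ *: _]addr0 rkhs_dot_linear ?rkhs_dot0l ?addr0//.
exact: rkhs0.
Qed.

Lemma rkhs_dotBl f g h : carrier f -> carrier g -> carrier h ->
  '[f - g, h] = '[f, h] - '[g, h].
Proof.
move=> Hf Hg Hh; rewrite -scaleN1r rkhs_dotDl ?rkhs_dotZl ?mulN1r//.
exact: rkhsZ.
Qed.

Lemma rkhs_dotDr f g h : carrier f -> carrier g -> carrier h ->
  '[f, g + h] = '[f, g] + '[f, h].
Proof.
move=> Hf Hg Hh; rewrite rkhs_dotC ?rkhs_dotDl//; last exact: rkhsD.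
by congr (_ + _); exact: rkhs_dotC.
Qed.

Lemma rkhs_dotZr a f h : carrier f -> carrier h -> '[f, a *: h] = a * '[f, h].
Proof.
move=> Hf Hh; rewrite rkhs_dotC ?rkhs_dotZl//; last exact: rkhsZ.
by congr (_ * _); exact: rkhs_dotC.
Qed.

Lemma rkhs_dotBr f g h : carrier f -> carrier g -> carrier h ->
  '[f, g - h] = '[f, g] - '[f, h].
Proof.
move=> Hf Hg Hh; rewrite -scaleN1r rkhs_dotDr ?rkhs_dotZr ?mulN1r//.
exact: rkhsZ.
Qed.

Lemma rkhs_dot_sumr n f (F : 'I_n -> T -> R) :
  carrier f -> (forall i, carrier (F i)) ->
  '[f, \sum_(i < n) F i] = \sum_(i < n) '[f, F i].
Proof.
move=> Hf HF.
suff [] : '[f, \sum_(i < n) F i] = \sum_(i < n) '[f, F i] /\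
  carrier (\sum_(i < n) F i) by [].
elim/big_rec2 : _ => [|i y z _ [<- Hz]].
  by split; [rewrite rkhs_dotC ?rkhs_dot0l//|]; exact: rkhs0.
by rewrite rkhs_dotDr//; split=> //; exact: rkhsD.
Qed.

Lemma rkhs_norm_sqr f : carrier f -> rkhs_norm H f ^+ 2 = '[f, f].
Proof. by move=> Hf; rewrite sqr_sqrtr// rkhs_dot_ge0. Qed.

Lemma rkhs_dot_addZ f g t : carrier f -> carrier g ->
  '[f + t *: g, f + t *: g] = '[f, f] + t * (2 * '[f, g]) + t ^+ 2 * '[g, g].
Proof.
move=> Hf Hg; have Htg := rkhsZ t _ Hg.
rewrite rkhs_dotDl ?rkhs_dotDr//; try exact: rkhsD.
rewrite !rkhs_dotZl ?rkhs_dotZr// (rkhs_dotC Hg Hf).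
by ring.
Qed.

Lemma rkhs_dotB_sqr f g : carrier f -> carrier g ->
  '[f - g, f - g] = '[f, f] - 2 * '[f, g] + '[g, g].
Proof.
by move=> Hf Hg; rewrite -scaleN1r rkhs_dot_addZ// sqrrN expr1n mul1r mulN1r.
Qed.

Lemma rkhs_cauchy_schwarz f g : carrier f -> carrier g ->
  '[f, g] ^+ 2 <= '[f, f] * '[g, g].
Proof.
move=> Hf Hg; apply: quadratic_ge0_discriminant => [|t].
  exact: rkhs_dot_ge0.
by rewrite -rkhs_dot_addZ// rkhs_dot_ge0//; apply/rkhsD/rkhsZ.
Qed.

Lemma rkhs_dot_kernel x y : '[k x, k y] = k x y.
Proof. by rewrite rkhs_reproducing//; exact: rkhs_kernel. Qed.

Lemma rkhs_kernelC x y : k x y = k y x.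
Proof.
by rewrite -rkhs_dot_kernel rkhs_dotC ?rkhs_dot_kernel//; exact: rkhs_kernel.
Qed.

(** Cauchy-Schwarz on the reproducing property: evaluations are bounded. *)
Lemma rkhs_sqr_bound f x : carrier f -> f x ^+ 2 <= '[f, f] * k x x.
Proof.
move=> Hf; rewrite -(rkhs_reproducing x Hf) -(rkhs_dot_kernel x x).
by apply: rkhs_cauchy_schwarz => //; exact: rkhs_kernel.
Qed.

(** The factor is the squared norm of [k x - k y]; elements of the space thus
    inherit the continuity of the kernel. *)
Lemma rkhs_increment_bound f x y : carrier f ->
  (f x - f y) ^+ 2 <= '[f, f] * (k x x - 2 * k x y + k y y).
Proof.
move=> Hf; have Hk := rkhs_kernel H.
rewrite -(rkhs_reproducing x Hf) -(rkhs_reproducing y Hf) -rkhs_dotBr//.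
rewrite -!rkhs_dot_kernel -rkhs_dotB_sqr//.
by apply: rkhs_cauchy_schwarz => //; exact: rkhsB.
Qed.

Section riesz.
Variables (L : (T -> R) -> R) (c : R).
Hypothesis c_ge0 : 0 <= c.
Hypothesis L_linear : forall a f g, carrier f -> carrier g ->
  L (a *: f + g) = a * L f + L g.
Hypothesis L_bounded : forall f, carrier f -> L f ^+ 2 <= c * '[f, f].

(** If [r] represents [L], then [energy f] is the squared norm of [f - r] up to a
    constant, so [r] is found by minimizing [energy]. *)
Let energy f := '[f, f] - 2 * L f.

Let energy_ge f : carrier f -> - c <= energy f.
Proof.
move=> Hf; rewrite /energy; have := L_bounded _ Hf.
have := rkhs_dot_ge0 Hf.
move: '[f, f] (L f) => G l G0 h; rewrite leNgt; apply/negP => lt_c.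
have Gc : 0 <= G + c by rewrite addr_ge0.
have Gcl : G + c < 2 * l by lra.
have := ltr_pM Gc Gc Gcl Gcl.
by have := sqr_ge0 (G - c); lra.
Qed.

Let energy_addZ f g t : carrier f -> carrier g ->
  energy (f + t *: g) =
  energy f + t * (2 * ('[f, g] - L g)) + t ^+ 2 * '[g, g].
Proof.
move=> Hf Hg; rewrite /energy rkhs_dot_addZ// [f + _]addrC L_linear//.
by ring.
Qed.

(** The parallelogram law at the midpoint of [f] and [g]: near-minimizers of the
    energy are close to each other, so minimizing sequences are Cauchy. *)
Let energy_parallelogram f g : carrier f -> carrier g ->
  '[f - g, f - g] =
  2 * energy f + 2 * energy g - 4 * energy (2^-1 *: (g - f) + f).
Proof.
move=> Hf Hg; have Hgf : carrier (g - f) by exact: rkhsB.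
have LB : L (g - f) = L g - L f by rewrite addrC -scaleN1r L_linear// mulN1r addrC.
rewrite [_ *: _ + _]addrC energy_addZ// !rkhs_dotB_sqr// rkhs_dotBr// LB.
by rewrite (rkhs_dotC Hg Hf) /energy; field.
Qed.

Let min_energy := inf [set energy f | f in carrier].

Let min_energy_le f : carrier f -> min_energy <= energy f.
Proof.
move=> Hf; apply: ge_inf; last by exists f.
by exists (- c) => _ [g Hg <-]; exact: energy_ge.
Qed.

Let minimizing_sequence : exists u : nat -> T -> R,
  forall n, carrier (u n) /\ energy (u n) < min_energy + n.+1%:R^-1.
Proof.
suff /choice[u uP] : forall n, exists f,
  carrier f /\ energy f < min_energy + n.+1%:R^-1 by exists u.
move=> n; have E0 : has_inf [set energy f | f in carrier].
  split; first by exists (energy 0); exists 0 => //; exact: rkhs0.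
  by exists (- c) => _ [g Hg <-]; exact: energy_ge.
have n_gt0 : 0 < n.+1%:R^-1 :> R by rewrite invr_gt0.
have [_ [f Hf <-] ?] := inf_adherent n_gt0 E0.
by exists f.
Qed.

(** A minimizing sequence [u] of the energy converges to some [r] by
    completeness.  Perturbing [u n] by [t *: g] shows that the inner product of
    [u n] and [g] differs from [L g] by at most the square root of the error
    times the norm of [g]; the bound passes to the limit. *)
Lemma rkhs_riesz : exists2 r, carrier r & forall f, carrier f -> '[f, r] = L f.
Proof.
have [u /all_and2[Hu u_min]] := minimizing_sequence.
have gap i j : '[u i - u j, u i - u j] <= 2 * (i.+1%:R^-1 + j.+1%:R^-1).
  rewrite energy_parallelogram//.
  have := u_min i; have := u_min j.
  have /min_energy_le : carrier (2^-1 *: (u j - u i) + u i).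
    by apply: rkhs_linear_closed => //; exact: rkhsB.
  move: (energy _) (energy (u i)) (energy (u j)) min_energy => e1 e2 e3 e4.
  move: (i.+1%:R^-1) (j.+1%:R^-1) => a b.
  by lra.
have [e e0|r Hr u_r] := @rkhs_complete _ _ _ H u Hu.
  have e40 : 0 < e ^+ 2 / 4 by rewrite divr_gt0// exprn_gt0.
  have [N _ NP] : \forall n \near \oo, n.+1%:R^-1 < e ^+ 2 / 4.
    exact: near_infty_natSinv_lt (PosNum e40).
  exists N => i j Ni Nj.
  rewrite -(gtr0_norm e0) -sqrtr_sqr ltr_sqrt ?exprn_gt0//.
  apply: le_lt_trans (gap i j) _.
  have := NP i Ni; have := NP j Nj; rewrite /=.
  by move: (i.+1%:R^-1) (j.+1%:R^-1) => a b; lra.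
exists r => // g Hg; rewrite rkhs_dotC//; apply/eqP; rewrite -subr_eq0 -sqrf_eq0.
rewrite eq_le sqr_ge0 andbT.
pose d n : R := '[u n - r, u n - r].
have Hur n : carrier (u n - r) by exact: rkhsB.
have bound n : ('[r, g] - L g) ^+ 2 <=
    2 * (n.+1%:R^-1 + Num.sqrt (d n) ^+ 2) * '[g, g].
  have h1 : ('[u n, g] - L g) ^+ 2 <= n.+1%:R^-1 * '[g, g].
    apply: quadratic_ge0_discriminant => [|t]; first exact: rkhs_dot_ge0.
    have /min_energy_le : carrier (u n + t *: g) by apply/rkhsD/rkhsZ.
    rewrite energy_addZ//; have := u_min n.
    by move: (energy _) min_energy (_^-1) => a b v; lra.
  have := rkhs_cauchy_schwarz _ _ (Hur n) Hg.
  rewrite sqr_sqrtr ?rkhs_dot_ge0// rkhs_dotBl//.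
  move: h1; rewrite -/(d n).
  move: '[r, g] '[u n, g] (L g) => a b l.
  move: (d n) (n.+1%:R^-1) '[g, g] => dn en G h1 h2.
  (* (a - l)^2 <= 2 (b - l)^2 + 2 (b - a)^2 *)
  by have := sqr_ge0 ((b - l) + (b - a)); lra.
have : 2 * (n.+1%:R^-1 + Num.sqrt (d n) ^+ 2) * '[g, g] @[n --> \oo] -->
    2 * (0 + 0 ^+ 2) * '[g, g].
  apply: cvgM; last exact: cvg_cst.
  apply: cvgM; first exact: cvg_cst.
  apply: cvgD; last by rewrite !expr2; apply: cvgM.
  exact: cvg_harmonic.
rewrite expr0n addr0 mulr0 mul0r => lim0.
rewrite -(cvg_lim _ lim0)//; apply: limr_ge.
  by apply/cvg_ex; exists 0.
exact: nearW.
Qed.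

End riesz.
End rkhs_theory.

(** * Mean elements of probability measures *)

Lemma bounded_measurable_integrable {d} {T : measurableType d} {R : realType}
    (m : {measure set T -> \bar R}) (f : T -> R) (c : R) :
  (m setT < +oo)%E -> measurable_fun setT f -> (forall x, `|f x| <= c) ->
  m.-integrable setT (EFin \o f).
Proof.
move=> moo mf fc; apply: measurable_bounded_integrable => //.
by exists c; split; [exact: num_real|move=> M /ltW cM x _; exact: le_trans cM].
Qed.

(** The boundedness of the kernel on the diagonal makes integration against [P] a
    bounded linear form; its Riesz representative is the mean element [m]. *)
Lemma rkhs_mean_element d (T : measurableType d) (R : realType)
    (k : T -> T -> R) (H : rkhs k) (P : probability T R) (M : R) :
  0 <= M -> (forall x, k x x <= M) ->
  (forall f, rkhs_carrier H f -> measurable_fun setT f) ->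
  let m := fun x => \int[P]_y k x y in
  rkhs_carrier H m /\
  forall f, rkhs_carrier H f -> rkhs_dot H f m = \int[P]_x f x.
Proof.
move=> M0 kM mH m.
have Poo : (P setT < +oo)%E by rewrite probability_setT ltry.
have f_le f x : rkhs_carrier H f -> `|f x| <= Num.sqrt (M * rkhs_dot H f f).
  move=> Hf; rewrite -sqrtr_sqr ler_wsqrtr//.
  apply: le_trans (rkhs_sqr_bound H _ x Hf) _.
  by rewrite mulrC ler_wpM2r// rkhs_dot_ge0.
have intH f : rkhs_carrier H f -> P.-integrable setT (EFin \o f).
  move=> Hf; apply: bounded_measurable_integrable (f_le _ ^~ Hf).
  - exact: Poo.
  - exact: mH.
have [a f g Hf Hg|f Hf|r Hr rE] :=
    @rkhs_riesz _ _ _ H (fun f => \int[P]_x f x) M M0.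
- rewrite -RintegralZl//; last exact: intH.
  rewrite -RintegralD//; last exact: intH.
  by have := intH _ (rkhsZ H a _ Hf).
- rewrite -real_normK ?num_real// -[leRHS]sqr_sqrtr; last first.
    by rewrite mulr_ge0// rkhs_dot_ge0.
  rewrite lerXn2r ?nnegrE ?sqrtr_ge0//.
  have int_f := intH _ Hf.
  apply: le_trans (le_normr_Rintegral _ _) _ => //.
  have -> : Num.sqrt (M * rkhs_dot H f f) =
      \int[P]_x Num.sqrt (M * rkhs_dot H f f).
    by rewrite Rintegral_cst//= probability_setT mulr1.
  apply: le_Rintegral => //.
  + exact: integrable_norm.
  + exact: finite_measure_integrable_cst.
  + by move=> x _; exact: f_le.
(* the representative is evaluated at [x] by pairing it with [k x] *)
suff -> : m = r by [].
apply/funext => x; rewrite /m -rE; last exact: rkhs_kernel.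
by rewrite rkhs_dotC ?rkhs_reproducing//; exact: rkhs_kernel.
Qed.

(** * Integrals against signed measures *)

Section charge_integral.
Context {d} {T : measurableType d} {R : realType}.

(** If the difference [p - n] equals the difference of the Jordan parts, then [n]
    plus the positive part and [p] plus the negative part are the same measure;
    integrating [f] against both and subtracting gives the claim. *)
Lemma charge_integral_sub (nu : {charge set T -> \bar R})
    (p n : {measure set T -> \bar R}) (f : T -> R) (c : R) :
  (p setT < +oo)%E -> (n setT < +oo)%E ->
  (forall A, measurable A -> nu A = p A - n A)%E ->
  measurable_fun setT f -> (forall x, `|f x| <= c) ->
  charge_integral nu f = \int[p]_x f x - \int[n]_x f x.
Proof.
move=> poo noo nuE mf fc; rewrite /charge_integral.
set jp := jordan_pos _; set jn := jordan_neg _.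
have jpoo : (jp setT < +oo)%E by rewrite -ge0_fin_numE// fin_num_measure.
have jnoo : (jn setT < +oo)%E by rewrite -ge0_fin_numE// fin_num_measure.
have int m moo := bounded_measurable_integrable m f c moo mf fc.
have fin (m : {measure set T -> \bar R}) A : measurable A -> (m setT < +oo)%E ->
    m A \is a fin_num.
  move=> mA moo; rewrite ge0_fin_numE//; apply: le_lt_trans moo.
  by apply: le_measure; rewrite ?inE.
have E : (\int[measure_add jp n]_x (f x)%:E = \int[measure_add p jn]_x (f x)%:E)%E.
  apply: eq_measure_integral => A mA _.
  suff : (jp A + n A = p A + jn A)%E by rewrite -!measure_addE.
  have := jordan_decomp (hahn_posneg nu) mA; rewrite nuE// -/jp -/jn.
  rewrite /cadd/= cscaleN1/=.
  move: (fin jp _ mA jpoo) (fin jn _ mA jnoo) (fin p _ mA poo) (fin n _ mA noo).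
  rewrite -/jp -/jn.
  move: (jp A) (jn A) (p A) (n A) => [a| |] [b| |] [v| |] [w| |]// _ _ _ _.
  by rewrite -!EFinN -!EFinD => -[] h; congr EFin; lra.
rewrite !integral_measure_add// in E; try exact: int.
have fI (m : {measure set T -> \bar R}) : (m setT < +oo)%E ->
    (\int[m]_x (f x)%:E = (\int[m]_x f x)%:E)%E.
  move=> moo; rewrite /Rintegral fineK//.
  by apply: integrable_fin_num => //; exact: int.
move: E; rewrite !fI// -!EFinD => -[]; lra.
Qed.

Lemma charge_integral_measure (P : probability T R) (f : T -> R) (c : R) :
  measurable_fun setT f -> (forall x, `|f x| <= c) ->
  charge_integral (charge_of_finite_measure P) f = \int[P]_x f x.
Proof.
have Poo : (P setT < +oo)%E by rewrite probability_setT ltry.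
move=> mf fc; rewrite (@charge_integral_sub _ P mzero f c)//.
- by rewrite /Rintegral integral_measure_zero subr0.
- by rewrite /= /mzero ltry.
- by move=> A mA; rewrite /= /mzero sube0.
Qed.

(** The charge is the difference of the two finite measures that carry its
    positive and its negative weights. *)
Lemma charge_integral_discrete n (x : 'I_n -> T) (w : 'I_n -> R)
    (f : T -> R) (c : R) :
  measurable_fun setT f -> (forall x, 0 <= f x <= c) ->
  charge_integral (discrete_charge x w) f = \sum_(i < n) w i * f (x i).
Proof.
move=> mf fc; have f0 y : 0 <= f y by have /andP[] := fc y.
(* the atoms of weight [v i] at the points [x i], as a finite measure *)
have weighted (v : 'I_n -> R) : (forall i, 0 <= v i) ->
    exists m : {measure set T -> \bar R}, [/\ (m setT < +oo)%E,
      forall A, (m A = \sum_(i < n) (v i)%:E * \d_(x i) A)%E &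
      \int[m]_y f y = \sum_(i < n) v i * f (x i)].
  move=> v0; pose a j : {measure set T -> \bar R} :=
    if insub j is Some i then mscale (NngNum (v0 i)) \d_(x i) else mzero.
  have aE (i : 'I_n) : a i = mscale (NngNum (v0 i)) \d_(x i) by rewrite /a valK.
  have mE A : (msum a n A = \sum_(i < n) (v i)%:E * \d_(x i) A)%E.
    by apply: eq_bigr => i _; rewrite aE.
  have moo : (msum a n setT < +oo)%E.
    rewrite mE (eq_bigr (fun i => (v i)%:E)) ?sumEFin ?ltry// => i _.
    by rewrite diracT mule1.
  exists (msum a n); split => //.
  rewrite /Rintegral.
  rewrite ge0_integral_measure_sum//; last 2 first.
  - by move=> y _; rewrite lee_fin.
  - exact/measurable_EFinP.
  rewrite (eq_bigr (fun i => (v i * f (x i))%:E)) ?sumEFin// => i _.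
  rewrite aE ge0_integral_mscale//=; last 2 first.
  - exact/measurable_EFinP.
  - by move=> y _; rewrite lee_fin.
  by rewrite integral_dirac ?diracT ?mul1e//; exact/measurable_EFinP.
pose wp i := Num.max (w i) 0; pose wn i := Num.max (- w i) 0.
have wE i : w i = wp i - wn i.
  by rewrite /wp /wn; case: (leP (w i) 0); case: (leP (- w i) 0); lra.
have [|p [poo pE If]] := weighted wp; first by move=> i; rewrite le_max lexx orbT.
have [|q [qoo qE Ig]] := weighted wn; first by move=> i; rewrite le_max lexx orbT.
rewrite (@charge_integral_sub _ p q f c)//.
- rewrite If Ig -sumrB; apply: eq_bigr => i _.
  by rewrite [in RHS]wE mulrBl.
- move=> A mA; rewrite pE qE.
  have dE v : (\sum_(i < n) (v i)%:E * \d_(x i) A =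
      (\sum_(i < n) v i * \1_A (x i))%:E)%E.
    by rewrite -sumEFin.
  rewrite -[LHS]/(\sum_(i < n) (w i)%:E * \d_(x i) A)%E !dE -EFinB -sumrB.
  congr EFin; apply: eq_bigr => i _.
  by rewrite [in LHS]wE mulrBl.
- by move=> y; rewrite ger0_norm//; have /andP[] := fc y.
Qed.

End charge_integral.

(** * Gaussian densities and the Gaussian kernel *)

Section gaussian.
Context {R : realType}.
Implicit Types (a b m s v x y z l : R).

(** Parametrized by the variance [v], the quantity that is additive under
    convolution. *)
Definition gauss_density v z : R :=
  (Num.sqrt (2 * pi * v))^-1 * expR (- z ^+ 2 / (2 * v)).

Lemma gauss_densityN v z : gauss_density v (- z) = gauss_density v z.
Proof. by rewrite /gauss_density sqrrN. Qed.

Lemma gauss_density_ge0 v z : 0 <= gauss_density v z.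
Proof. by rewrite mulr_ge0 ?expR_ge0// invr_ge0 sqrtr_ge0. Qed.

Lemma gauss_density_le v z : 0 < v -> gauss_density v z <= gauss_density v 0.
Proof.
move=> v0; rewrite ler_wpM2l ?invr_ge0 ?sqrtr_ge0// ler_expR.
by rewrite ler_pM2r ?invr_gt0 ?mulr_gt0// lerN2 expr0n sqr_ge0.
Qed.

Lemma gauss_density0 v : gauss_density v 0 = (Num.sqrt (2 * pi * v))^-1.
Proof. by rewrite /gauss_density expr0n oppr0 mul0r expR0 mulr1. Qed.

Lemma continuous_gauss_density v : continuous (gauss_density v).
Proof.
move=> z; apply: cvgM; first exact: cvg_cst.
apply: (cvg_comp _ expR); last exact: continuous_expR.
apply: cvgM; last exact: cvg_cst.
apply: (@cvgN _ R^o).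
exact: sqr_continuous.
Qed.

Lemma measurable_gauss_density v m :
  measurable_fun setT (fun y : measurableTypeR R => gauss_density v (m - y)).
Proof.
apply: (measurableT_comp (f := gauss_density v)).
  by apply: continuous_measurable_fun; exact: continuous_gauss_density.
exact: measurable_funB.
Qed.

Lemma normal_pdf_gauss m s y : s != 0 ->
  normal_pdf m s y = gauss_density (s ^+ 2) (y - m).
Proof.
move=> s0; rewrite normal_pdfE// /normal_peak /normal_fun /gauss_density.
congr ((Num.sqrt _)^-1 * expR (_ / _)); first by rewrite mulr2n; ring.
by rewrite mulr2n; ring.
Qed.

(** Completing the square in [y]. *)
Lemma gauss_density_mul a b x y m : 0 < a -> 0 < b ->
  gauss_density a (x - y) * gauss_density b (y - m) =
  gauss_density (a + b) (x - m) *
  gauss_density (a * b / (a + b)) (y - (x * b + m * a) / (a + b)).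
Proof.
move=> a0 b0; have ab0 : 0 < a + b by rewrite addr_gt0.
have p0 : 0 < pi :> R by exact: pi_gt0.
rewrite /gauss_density !mulrA.
rewrite ![_ * expR _ / _]mulrAC -!mulrA -!expRD !mulrA -!invfM -!sqrtrM; try nra.
congr ((Num.sqrt _)^-1 * expR _); first by field; rewrite gt_eqF.
field.
by rewrite !gt_eqF.
Qed.

(** The normal law is absolutely continuous, and its Radon-Nikodym derivative
    agrees almost everywhere with [normal_pdf] since both have the same integral
    over every measurable set. *)
Lemma integral_normal_prob m s (f : R -> R) (c : R) : s != 0 ->
  measurable_fun setT (f : measurableTypeR R -> R) -> (forall y, `|f y| <= c) ->
  \int[normal_prob m s]_y f y =
  \int[lebesgue_measure]_y (f y * normal_pdf m s y).
Proof.
move=> s0 mf fc; rewrite /Rintegral; congr fine.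
have Poo : (normal_prob m s setT < +oo)%E by rewrite probability_setT ltry.
rewrite -(Radon_Nikodym_change_of_variables (normal_prob_dominates m s))//=;
  last first.
  exact: (bounded_measurable_integrable _ _ c).
apply: ae_eq_integral => //.
- apply: emeasurable_funM => //; first exact/measurable_EFinP.
  apply: (measurable_int lebesgue_measure).
  by apply: Radon_Nikodym_integrable; exact: normal_prob_dominates.
- apply/measurable_EFinP; apply: measurable_funM => //.
  exact: measurable_normal_pdf.
- under [X in ae_eq _ _ _ X]eq_fun do rewrite EFinM.
  apply: ae_eqe_mul2l => /=.
  rewrite Radon_NikodymE//=; first exact: normal_prob_dominates.
  move=> nu_mu; case: cid => /= h [h1 h2 h3].
  apply: integral_ae_eq => //=.
  + by apply/measurable_EFinP; exact: measurable_normal_pdf.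
  + by move=> E _ mE; rewrite -h3.
Qed.

(** By [gauss_density_mul] the integrand is a constant in [y] times a normal
    density. *)
Lemma gauss_density_convolution a x m s : 0 < a -> 0 < s ->
  \int[normal_prob m s]_y gauss_density a (x - y) =
  gauss_density (a + s ^+ 2) (x - m).
Proof.
move=> a0 s0; have s20 : 0 < s ^+ 2 by rewrite exprn_gt0.
rewrite (@integral_normal_prob _ _ _ (gauss_density a 0)) ?gt_eqF//; last 2 first.
- exact: measurable_gauss_density.
- by move=> y; rewrite ger0_norm ?gauss_density_ge0// gauss_density_le.
pose v := a * s ^+ 2 / (a + s ^+ 2).
have v0 : 0 < v by rewrite divr_gt0 ?mulr_gt0 ?addr_gt0.
pose c := (x * s ^+ 2 + m * a) / (a + s ^+ 2).
transitivity (\int[lebesgue_measure]_y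
    (gauss_density (a + s ^+ 2) (x - m) * normal_pdf c (Num.sqrt v) y)).
  apply: eq_Rintegral => y _; rewrite !normal_pdf_gauss ?gt_eqF ?sqrtr_gt0//.
  by rewrite gauss_density_mul// sqr_sqrtr// ltW.
rewrite RintegralZl//; last exact: integrable_normal_pdf.
by rewrite /Rintegral integral_normal_pdf mulr1.
Qed.

Lemma gauss_kernelE l x y : gauss_kernel l x y = gauss_density (l ^+ 2) (x - y).
Proof. by []. Qed.

(** Measurability comes from continuity, which [rkhs_increment_bound] transfers
    from the kernel. *)
Lemma gauss_rkhs_measurable l (H : rkhs (gauss_kernel l))
    (f : measurableTypeR R -> R) :
  rkhs_carrier H f -> measurable_fun setT f.
Proof.
move=> Hf; apply: continuous_measurable_fun => x.
(* [q y] bounds the increment of [f] between [x] and [y] *)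
pose q (y : R) : R := Num.sqrt (rkhs_dot H f f *
  (2 * (gauss_density (l ^+ 2) 0 - gauss_density (l ^+ 2) (x - y)))).
have q_cvg0 : q y @[y --> x] --> (0 : R).
  have : q y @[y --> x] --> Num.sqrt (rkhs_dot H f f *
      (2 * (gauss_density (l ^+ 2) 0 - gauss_density (l ^+ 2) (x - x)))).
    apply: (cvg_comp _ Num.sqrt); last exact: sqrt_continuous.
    apply: cvgM; first exact: cvg_cst.
    apply: cvgM; first exact: cvg_cst.
    apply: (@cvgB _ R^o); first exact: cvg_cst.
    apply: (cvg_comp _ (gauss_density (l ^+ 2))).
      by apply: (@cvgB _ R^o); [exact: cvg_cst|exact: cvg_id].
    exact: continuous_gauss_density.
  by rewrite !subrr !mulr0 sqrtr0.
have fq y : `|f x - f y| <= q y.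
  rewrite -sqrtr_sqr ler_wsqrtr//.
  apply: le_trans (rkhs_increment_bound H f x y Hf) _.
  rewrite !gauss_kernelE !subrr ler_wpM2l ?rkhs_dot_ge0//.
  by lra.
apply: (@squeeze_cvgr _ _ _ R (fun y => f x - q y) (fun y => f x + q y) f).
- by apply: nearW => y; rewrite -ler_distlC.
- have : f x - q y @[y --> x] --> f x - 0.
    by apply: (@cvgB _ R^o) => //; exact: cvg_cst.
  by rewrite subr0.
- have : f x + q y @[y --> x] --> f x + 0.
    by apply: (@cvgD _ R^o) => //; exact: cvg_cst.
  by rewrite addr0.
Qed.

(** The hypothesis says that a Vandermonde matrix with distinct nodes [expR (x i)]
    kills [c]. *)
Lemma expR_powers_free n (x c : 'I_n -> R) : injective x ->
  (forall j : nat, \sum_(i < n) c i * expR (x i) ^+ j = 0) ->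
  forall i, c i = 0.
Proof.
move=> x_inj sum0 i.
pose V := Vandermonde n (\row_i expR (x i)).
have V_unit : V \in unitmx.
  rewrite unitmxE unitfE det_Vandermonde; apply/prodf_neq0 => j _.
  apply/prodf_neq0 => i' ji'; rewrite !mxE subr_eq0.
  apply/eqP => /expR_inj/x_inj E; by rewrite E ltnn in ji'.
have V0 : V *m \col_i c i = 0.
  apply/colP => j; rewrite !mxE -[RHS](sum0 j); apply: eq_bigr => i' _.
  by rewrite !mxE mulrC.
have : \col_i c i = 0 by rewrite -(mulKmx V_unit (\col_i c i)) V0 mulmx0.
by move=> /colP/(_ i); rewrite !mxE.
Qed.

(** Expanding the square in the exponent factors [gauss_kernel l (x i) y] into a
    function of [x i], a function of [y] and [expR (x i * y / l ^+ 2)]; the points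
    [y = j * l ^+ 2] turn the last factor into powers of [expR (x i)]. *)
Lemma gauss_kernel_free l n (x c : 'I_n -> R) : 0 < l -> injective x ->
  \sum_(i < n) c i *: gauss_kernel l (x i) = 0 -> forall i, c i = 0.
Proof.
move=> l0 x_inj sum0 i; have l2 : l ^+ 2 != 0 by rewrite gt_eqF// exprn_gt0.
pose A i : R := expR (- x i ^+ 2 / (2 * l ^+ 2)).
suff /(_ i)/eqP : forall i, c i * A i = 0.
  by rewrite mulf_eq0 [A i == 0]gt_eqF ?expR_gt0 ?orbF => // /eqP.
apply: (expR_powers_free n x (fun i => c i * A i) x_inj) => j.
pose y : R := j%:R * l ^+ 2.
pose B : R := (Num.sqrt (2 * pi * l ^+ 2))^-1 * expR (- y ^+ 2 / (2 * l ^+ 2)).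
have B0 : B != 0.
  rewrite gt_eqF// mulr_gt0 ?expR_gt0// invr_gt0 sqrtr_gt0.
  by rewrite !mulr_gt0 ?pi_gt0 ?exprn_gt0.
apply: (mulfI B0); rewrite mulr0.
transitivity ((\sum_(i < n) c i *: gauss_kernel l (x i)) y); last by rewrite sum0.
rewrite fct_sumE mulr_sumr; apply: eq_bigr => i' _.
rewrite -[RHS]/(c i' * gauss_kernel l (x i') y) /gauss_kernel /B /A -expRM_natl.
rewrite [RHS]mulrCA -!mulrA; congr (_ * _).
rewrite mulrCA; congr (_ * _).
by rewrite -!expRD; congr expR; rewrite /y; field; rewrite gt_eqF.
Qed.

End gaussian.

(** * Projection onto finitely many kernel sections *)

Section rkhs_interpolation.
Context {R : realType} {T : Type} {k : T -> T -> R} (H : rkhs k).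
Context {n : nat} (x : 'I_n -> T).

Local Notation comb u := (\sum_(i < n) u i 0 *: k (x i)).
Local Notation K := (\matrix_(i, j) k (x i) (x j) : 'M[R]_n).

Hypothesis k_free : forall u : 'cV[R]_n, comb u = 0 -> u = 0.

Let Hcomb (u : 'cV[R]_n) : rkhs_carrier H (comb u).
Proof. by apply: rkhs_sum => i; apply/rkhsZ/rkhs_kernel. Qed.

Let dot_comb f (u : 'cV[R]_n) : rkhs_carrier H f ->
  rkhs_dot H f (comb u) = \sum_(i < n) u i 0 * f (x i).
Proof.
have Hk := rkhs_kernel H.
move=> Hf; rewrite rkhs_dot_sumr//; last by move=> i; exact: rkhsZ.
by apply: eq_bigr => i _; rewrite rkhs_dotZr// rkhs_reproducing.
Qed.

Lemma combination_eval (u : 'cV[R]_n) i : comb u (x i) = (K *m u) i 0.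
Proof.
rewrite fct_sumE !mxE; apply: eq_bigr => j _.
by rewrite !mxE mulrC (rkhs_kernelC H).
Qed.

(** A kernel vector of [K] gives a combination of zero norm. *)
Lemma gram_unitmx : K \in unitmx.
Proof.
rewrite -row_free_unit; apply: inj_row_free => v vK0.
have KT : K^T = K by apply/matrixP => i j; rewrite !mxE (rkhs_kernelC H).
have Kv0 : K *m v^T = 0 by rewrite -[K]KT -trmx_mul vK0 trmx0.
apply: trmx_inj; rewrite trmx0; apply: k_free.
apply: (rkhs_dot_eq0 (Hcomb _)); rewrite dot_comb//.
by rewrite big1// => i _; rewrite combination_eval Kv0 [X in _ * X]mxE mulr0.
Qed.

Variables (f : T -> R).
Hypothesis Hf : rkhs_carrier H f.

Let m : 'cV[R]_n := \col_i f (x i).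
Let w : 'cV[R]_n := invmx K *m m.

Let residual_eval i : (f - comb w) (x i) = 0.
Proof.
rewrite -[LHS]/(f (x i) - comb w (x i)) combination_eval mulKVmx ?gram_unitmx//.
by rewrite mxE subrr.
Qed.

(** The residual of [w] vanishes at the points [x i], hence is orthogonal to every
    combination of the [k (x i)]. *)
Lemma residual_pythagoras (u : 'cV[R]_n) :
  rkhs_dot H (f - comb u) (f - comb u) =
  rkhs_dot H (f - comb w) (f - comb w) +
  rkhs_dot H (comb (w - u)) (comb (w - u)).
Proof.
have -> : f - comb u = (f - comb w) + 1 *: comb (w - u).
  rewrite scale1r -addrA; congr (_ + _).
  rewrite -!sumrN -big_split/=; apply: eq_bigr => i _.
  by rewrite !mxE scalerBl addrA addNr add0r.
rewrite rkhs_dot_addZ//; last exact: rkhsB.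
rewrite dot_comb; last exact: rkhsB.
rewrite (big1 _ _ (fun i => (w - u) i 0 * _)) => [|i _].
  by rewrite !mulr0 addr0 expr1n mul1r.
by rewrite residual_eval mulr0.
Qed.

Lemma residual_minimal (v : 'cV[R]_n) :
  (forall u : 'cV[R]_n, rkhs_norm H (f - comb v) <= rkhs_norm H (f - comb u))
  <-> v = w.
Proof.
split=> [/(_ w)|-> u]; last first.
  by rewrite ler_wsqrtr// (residual_pythagoras u) lerDl rkhs_dot_ge0.
rewrite ler_sqrt; last by rewrite rkhs_dot_ge0//; exact: rkhsB.
rewrite (residual_pythagoras v) gerDl => le0.
apply/esym/eqP; rewrite -subr_eq0; apply/eqP/k_free.
by apply: (rkhs_dot_eq0 (Hcomb _)); apply/eqP; rewrite eq_le le0 rkhs_dot_ge0.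
Qed.

(** By orthogonality the squared norm is the inner product of the residual with
    [f]. *)
Lemma residual_sqr : rkhs_dot H (f - comb w) (f - comb w) =
  rkhs_dot H f f - \sum_(i < n) \sum_(j < n) f (x i) * f (x j) * invmx K i j.
Proof.
rewrite rkhs_dotBr//; last exact: rkhsB.
rewrite (dot_comb _ w)//; last exact: rkhsB.
rewrite (big1 _ _ (fun i => w i 0 * _)) => [|i _]; last first.
  by rewrite residual_eval mulr0.
rewrite subr0 rkhs_dotBl// (rkhs_dotC (Hcomb w) Hf) dot_comb//.
congr (_ - _); apply: eq_bigr => i _.
rewrite mxE mulr_suml; apply: eq_bigr => j _; rewrite mxE.
by ring.
Qed.

End rkhs_interpolation.

(** * Embedding and optimal weights for the normal distribution *)

Theorem mainTheorem4 (R : realType) (mu sigma l : R)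
    (sigma_gt0 : 0 < sigma) (l_gt0 : 0 < l) (H : rkhs (gauss_kernel l)) :
  let k := gauss_kernel l in
  let P := charge_of_finite_measure (normal_prob mu sigma) in
  let Pk := embedding k P in
  [/\ rkhs_carrier H Pk,
      forall x : R, Pk x = \int[normal_prob mu sigma]_y k x y,
      forall x : R, Pk x =
        (Num.sqrt (2 * pi * (sigma ^+ 2 + l ^+ 2)))^-1 *
        expR (- (x - mu) ^+ 2 / (2 * (sigma ^+ 2 + l ^+ 2))) &
      forall (n : nat) (x : 'I_n -> R), injective x ->
        let K : 'M[R]_n := \matrix_(i, j) k (x i) (x j) in
        let m : 'cV[R]_n := \col_i Pk (x i) in
        let w : 'cV[R]_n := invmx K *m m in
        let mun := discrete_charge (T := measurableTypeR R) x (fun i => w i 0) in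
        [/\ K \in unitmx,
            forall v : 'cV[R]_n,
              (forall u : 'cV[R]_n,
                 rkhs_norm H (Pk - \sum_(i < n) v i 0 *: k (x i)) <=
                 rkhs_norm H (Pk - \sum_(i < n) u i 0 *: k (x i)))
              <-> v = w &
            MMD H P mun ^+ 2 =
              (Num.sqrt (2 * pi * (2 * sigma ^+ 2 + l ^+ 2)))^-1
              - (2 * pi * (sigma ^+ 2 + l ^+ 2))^-1 *
                \sum_(i < n) \sum_(j < n)
                  expR (- ((x i - mu) ^+ 2 + (x j - mu) ^+ 2) /
                        (2 * (sigma ^+ 2 + l ^+ 2))) * invmx K i j] ].
Proof.
move=> k P Pk.
have l2 : 0 < l ^+ 2 by rewrite exprn_gt0.
have s2 : 0 < sigma ^+ 2 by rewrite exprn_gt0.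
have v0 : 0 < sigma ^+ 2 + l ^+ 2 by rewrite addr_gt0.
have k_bounded x y : 0 <= k x y <= gauss_density (l ^+ 2) 0.
  by rewrite /k gauss_kernelE gauss_density_ge0 gauss_density_le.
have k_measurable x : measurable_fun setT (k x).
  exact: measurable_gauss_density.
have PkE x : Pk x = \int[normal_prob mu sigma]_y k x y.
  apply: (@charge_integral_measure _ _ _ _ _ (gauss_density (l ^+ 2) 0)) => //.
  by move=> y; have /andP[k0 ?] := k_bounded x y; rewrite ger0_norm.
have Pk_density x : Pk x = gauss_density (sigma ^+ 2 + l ^+ 2) (x - mu).
  by rewrite PkE gauss_density_convolution// addrC.
have [HPk dotPk] : rkhs_carrier H Pk /\ forall f, rkhs_carrier H f ->
    rkhs_dot H f Pk = \int[normal_prob mu sigma]_x f x.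
  rewrite (_ : Pk = fun x => \int[normal_prob mu sigma]_y k x y); last exact/funext.
  apply: (rkhs_mean_element _ _ _ _ _ _ (gauss_density (l ^+ 2) 0)).
  - exact: gauss_density_ge0.
  - by move=> x; have /andP[] := k_bounded x x.
  - exact: gauss_rkhs_measurable.
split => // n x x_inj K m w mun.
have k_free (u : 'cV[R]_n) : \sum_(i < n) u i 0 *: k (x i) = 0 -> u = 0.
  move=> /(gauss_kernel_free _ _ _ _ l_gt0 x_inj) u0.
  by apply/colP => i; rewrite u0 mxE.
have PkPk : rkhs_dot H Pk Pk = (Num.sqrt (2 * pi * (2 * sigma ^+ 2 + l ^+ 2)))^-1.
  rewrite dotPk// -gauss_density0.
  transitivity (\int[normal_prob mu sigma]_y
      gauss_density (sigma ^+ 2 + l ^+ 2) (mu - y)).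
    by apply: eq_Rintegral => y _; rewrite Pk_density -opprB gauss_densityN.
  rewrite gauss_density_convolution// subrr.
  by congr gauss_density; ring.
split.
- exact: (gram_unitmx H _ k_free).
- by move=> v; exact: (residual_minimal H _ k_free _ HPk).
have munE : embedding k mun = \sum_(i < n) w i 0 *: k (x i).
  apply/funext => y; rewrite fct_sumE.
  rewrite /embedding (charge_integral_discrete _ _ _ _ (gauss_density (l ^+ 2) 0))//.
  by apply: eq_bigr => i _; congr (_ * _); exact: (rkhs_kernelC H).
rewrite /MMD munE rkhs_norm_sqr; last first.
  by apply: rkhsB => //; apply: rkhs_sum => i; apply/rkhsZ/rkhs_kernel.
rewrite (residual_sqr H _ k_free _ HPk) PkPk; congr (_ - _).
rewrite mulr_sumr; apply: eq_bigr => i _.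
rewrite mulr_sumr; apply: eq_bigr => j _.
rewrite mulrA; congr (_ * _).
rewrite !Pk_density /gauss_density mulrACA -expRD -invfM -expr2 sqr_sqrtr.
  by congr (_ * expR _); ring.
by rewrite !mulr_ge0 ?pi_ge0// ltW.
Qed.
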